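(* Let $G$ be a finite group. Then $$\omega(\Gamma_1(G))=\omega(\Gamma(G))-1=\max\{\mathrm{weight}(o(a))\mid a\in G\}.$$
   Context: For a finite group $G$, $\Gamma(G)$ is the simple undirected graph with vertex set $G$, in which two distinct vertices $x,y$ are adjacent if and only if one of them is a power of the other; $\Gamma_1(G)$ is the induced subgraph on $G\setminus\{1\}$. $\omega(L)$ denotes the clique number of a graph $L$ (the maximum number of vertices of a complete subgraph; $0$ for the empty graph), and $o(a)$ is the order of $a$. For a positive integer $n$, a set $A=\{d_1,\dots,d_t\}$ of divisors of $n$, all greater than $1$, is called a CD-set of $n$ if for any two elements of $A$ one divides the other; a CD-set of $n$ that is maximal with respect to inclusion is called an MCD-set of $n$. Put $\mathrm{weight}(A)=\varphi(d_1)+\cdots+\varphi(d_t)$, where $\varphi$ is Euler's totient function, and $\mathrm{weight}(n)=\max\{\mathrm{weight}(A)\mid A \text{ is an MCD-set of } n\}$. For $n=1$ the only MCD-set is the empty set, and $\mathrm{weight}(1)=0$. *)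

(* Defs.v *)
From mathcomp Require Import all_boot all_fingroup.

Set Implicit Arguments.
Unset Strict Implicit.
Unset Printing Implicit Defensive.

Local Open Scope nat_scope.

Record sgraph (T : finType) := SGraph {
  vset : {set T};
  adj : rel T;
  adj_vset : forall x y, adj x y -> x \in vset;
  adj_sym : symmetric adj;
  adj_irr : irreflexive adj }.

Section Induced.

Variables (T : finType) (L : sgraph T) (A : {set T}).

Definition induced_adj : rel T :=
  fun x y => [&& x \in A, y \in A & adj L x y].

Fact induced_vset x y : induced_adj x y -> x \in vset L :&: A.
Proof. by case/and3P=> xA _ /adj_vset xL; rewrite inE xL xA. Qed.

Fact induced_sym : symmetric induced_adj.
Proof. by move=> x y; rewrite /induced_adj adj_sym andbCA. Qed.

Fact induced_irr : irreflexive induced_adj.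
Proof. by move=> x; rewrite /induced_adj adj_irr !andbF. Qed.

Definition induced : sgraph T := SGraph induced_vset induced_sym induced_irr.

End Induced.

Definition clique (T : finType) (L : sgraph T) (C : {set T}) : bool :=
  (C \subset vset L) && [forall x in C, forall y in C, (x != y) ==> adj L x y].

Definition clique_number (T : finType) (L : sgraph T) : nat :=
  \max_(C : {set T} | clique L C) #|C|.

Definition is_power (gT : finGroupType) (x y : gT) : bool := x \in <[y]>%g.

Lemma is_powerP (gT : finGroupType) (x y : gT) :
  reflect (exists n : nat, x = (y ^+ n)%g) (is_power x y).
Proof. exact: cycleP. Qed.

Section PowerGraph.

Variables (gT : finGroupType) (G : {group gT}).

Definition power_adj : rel gT :=
  fun x y =>
    [&& x \in G, y \in G, x != y & is_power x y || is_power y x].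

Fact power_vset x y : power_adj x y -> x \in (G : {set gT}).
Proof. by case/and4P. Qed.

Fact power_sym : symmetric power_adj.
Proof. by move=> x y; rewrite /power_adj andbCA eq_sym orbC. Qed.

Fact power_irr : irreflexive power_adj.
Proof. by move=> x; rewrite /power_adj eqxx !andbF. Qed.

Definition power_graph : sgraph gT := SGraph power_vset power_sym power_irr.

Definition power_graph1 : sgraph gT := induced power_graph (G :\ 1%g).

(* Hence truncated subtraction in [clique_number power_graph - 1] is exact. *)
Lemma clique_number_power_graph_gt0 : 0 < clique_number power_graph.
Proof.
have c1 : clique power_graph [set 1%g].
  rewrite /clique sub1set group1; apply/forall_inP=> x /set1P ->.
  by apply/forall_inP=> y /set1P ->; rewrite eqxx.
by apply: leq_trans (leq_bigmax_cond _ c1); rewrite cards1.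
Qed.

End PowerGraph.

(* For n > 0 every divisor of n lies in {0, ..., n}, so sets of divisors of n *)
(* are encoded as subsets of 'I_n.+1; only n > 0 is meaningful below.         *)
Definition CD_set (n : nat) (A : {set 'I_n.+1}) : bool :=
  [forall d in A, (d %| n) && (1 < d)] &&
  [forall d in A, forall e in A, (d %| e) || (e %| d)].

Definition MCD_set (n : nat) (A : {set 'I_n.+1}) : bool := maxset (@CD_set n) A.

Definition set_weight (n : nat) (A : {set 'I_n.+1}) : nat :=
  \sum_(d in A) totient d.

Definition weight (n : nat) : nat :=
  \max_(A : {set 'I_n.+1} | MCD_set A) set_weight A.

(* Main.v *)
Require Import Defs.
From mathcomp Require Import all_boot all_fingroup.
From mathcomp Require Import cyclic.

(* A nonempty clique of the power graph lies in the cyclic group generated by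
   any of its elements [a] of maximal order, so only cyclic groups matter.
   In <[a]> two elements are adjacent exactly when the order of one divides
   the order of the other, and there are phi(d) elements of each order d
   dividing #[a]: cliques avoiding 1 thus correspond to CD-sets of #[a], with
   weights bounding cardinals. *)

(** A cyclic group has a unique subgroup of each order [d] dividing its own; the elements of order
    [d] are the generators of that subgroup. *)
Lemma card_order_cycle {gT : finGroupType} {a : gT} {d : nat} :
  d %| #[a]%g -> #|[set x in <[a]>%g | #[x]%g == d]| = totient d.
Proof.
move=> d_dv_a.
have [b ab ob] : exists2 b, b \in <[a]>%g & #[b]%g = d.
  exists (a ^+ (#[a] %/ d))%g; first exact: mem_cycle.
  by rewrite orderXdiv ?dvdn_div // divnA // mulKn ?order_gt0.
rewrite -ob totient_gen; apply: eq_card => x; rewrite !inE /generator.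
apply/andP/eqP => [[ax /eqP oxb]|eq_bx].
  apply/eqP; rewrite eq_sym (eq_subG_cyclic (cycle_cyclic a)) ?cycle_subG //.
  exact/eqP.
split; last by rewrite !orderE eq_bx.
by rewrite -cycle_subG -eq_bx cycle_subG.
Qed.

(** Inclusion between subgroups of a cyclic group is divisibility of their orders; this turns
    adjacency in [<[a]>] into the CD-set condition. *)
Lemma mem_cycle_order_dvd {gT : finGroupType} {a x y : gT} :
  x \in <[a]>%g -> y \in <[a]>%g -> (x \in <[y]>%g) = (#[x]%g %| #[y]%g).
Proof.
move=> ax ay; rewrite -cycle_subG !orderE.
by rewrite (cardSg_cyclic (cycle_cyclic a)) ?cycle_subG.
Qed.

(** Orders in [<[a]>] divide [#[a]], so [inord] never falls back on its default value. *)
Lemma inord_orderK {gT : finGroupType} {a x : gT} :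
  x \in <[a]>%g -> (inord #[x]%g : 'I_#[a]%g.+1) = #[x]%g :> nat.
Proof. by move=> ax; rewrite inordK // ltnS dvdn_leq ?order_gt0 ?order_dvdG. Qed.

(** Sorting the elements by order gives one fibre of size [totient d] for each [d] in [A]. *)
Lemma card_order_in_CD_set {gT : finGroupType} {a : gT}
    {A : {set 'I_#[a]%g.+1}} :
  CD_set A -> #|[set x in <[a]>%g | inord #[x]%g \in A]| = set_weight A.
Proof.
case/andP=> /forall_inP dvA _; rewrite -sum1_card.
rewrite (partition_big (fun x => inord #[x]%g : 'I_#[a]%g.+1) (mem A)) => [|x].
  apply: eq_bigr => d dA; have /andP[d_dv _] := dvA d dA.
  rewrite -(card_order_cycle d_dv) -sum1_card; apply: eq_bigl => x.
  rewrite !inE -andbA; apply: andb_id2l => ax.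
  rewrite -(inj_eq val_inj) /= inord_orderK //.
  apply/andP/idP => [[]//|/eqP oxd]; split; last by rewrite oxd.
  by rewrite oxd inord_val.
by rewrite inE => /andP[].
Qed.

(** Enlarging [A] to a maximal CD-set only adds nonnegative terms to the sum. *)
Lemma weight_max_CD_set {n : nat} {A : {set 'I_n.+1}} :
  CD_set A -> set_weight A <= weight n.
Proof.
move=> cdA; have [B maxB sAB] := maxset_exists cdA.
apply: (bigmax_sup B) => //; rewrite /set_weight.
rewrite [X in _ <= X](big_setID A) /= (setIidPr sAB); exact: leq_addr.
Qed.

(** Distinctness disappears from the condition because every element is a power of itself. *)
Lemma clique_power_graphP {gT : finGroupType} {G : {group gT}} {C : {set gT}} :
  reflect (C \subset G /\
           {in C &, forall x y, (x \in <[y]>%g) || (y \in <[x]>%g)})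
          (clique (power_graph G) C).
Proof.
apply: (iffP andP) => [[sCG /forall_inP adjC]|[sCG adjC]]; split=> //.
  move=> x y xC yC; have [->|neq_xy] := eqVneq x y; first by rewrite cycle_id.
  have /forall_inP/(_ y yC) := adjC x xC.
  by rewrite neq_xy => /and4P[].
apply/forall_inP=> x xC; apply/forall_inP=> y yC; apply/implyP=> neq_xy.
by apply/and4P; split; rewrite ?(subsetP sCG) //; apply: adjC.
Qed.

Lemma clique_power_graph1E {gT : finGroupType} {G : {group gT}}
    {C : {set gT}} :
  clique (power_graph1 G) C = clique (power_graph G) C && (1%g \notin C).
Proof.
rewrite /clique /= subsetI subsetD1 andbA andbb.
case: (boolP (1%g \in C)) => [_|nC1]; first by rewrite !andbF.
rewrite !andbT; apply: andb_id2l => sCG.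
apply: eq_forallb_in => x xC; apply: eq_forallb_in => y yC.
rewrite /induced_adj !inE !(subsetP sCG) //=.
by rewrite !(memPn nC1).
Qed.

Lemma clique_power_graphD1 {gT : finGroupType} {G : {group gT}}
    {C : {set gT}} :
  clique (power_graph G) C -> clique (power_graph1 G) (C :\ 1%g).
Proof.
case/clique_power_graphP=> sCG adjC.
rewrite clique_power_graph1E setD11 andbT; apply/clique_power_graphP.
split; first exact: subset_trans (subsetDl _ _) sCG.
by move=> x y /setD1P[_ xC] /setD1P[_ yC]; apply: adjC.
Qed.

Lemma clique_power_graphU1 {gT : finGroupType} {G : {group gT}}
    {C : {set gT}} :
  clique (power_graph G) C -> clique (power_graph G) (1%g |: C).
Proof.
case/clique_power_graphP=> sCG adjC; apply/clique_power_graphP.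
split; first by rewrite subUset sub1set group1.
move=> x y /setU1P[->|xC] /setU1P[->|yC]; rewrite ?group1 ?orbT //.
exact: adjC.
Qed.

(** Being a power of every element, [1] can be added to any clique; removing it costs at most one
    vertex. *)
Lemma clique_number_power_graph1 {gT : finGroupType} {G : {group gT}} :
  clique_number (power_graph1 G) = clique_number (power_graph G) - 1.
Proof.
apply/eqP; rewrite eqn_leq leq_subLR; apply/andP; split.
  apply/bigmax_leqP=> C; rewrite clique_power_graph1E => /andP[cC nC1].
  rewrite -(leq_add2l 1) subnKC ?clique_number_power_graph_gt0 //.
  by apply: (bigmax_sup (1%g |: C)); rewrite ?clique_power_graphU1 ?cardsU1 ?nC1.
apply/bigmax_leqP=> C cC; rewrite (cardsD1 1%g C) leq_add ?leq_b1 //.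
by apply: (bigmax_sup (C :\ 1%g)); rewrite ?clique_power_graphD1.
Qed.

Lemma clique_power_graph_sub_cycle {gT : finGroupType} {G : {group gT}}
    {C : {set gT}} :
  clique (power_graph G) C -> C != set0 ->
  exists2 a, a \in C & C \subset <[a]>%g.
Proof.
case/clique_power_graphP=> sCG adjC /set0Pn[c cC].
case: (arg_maxnP (fun x : gT => #[x]%g) cC) => a aC max_a.
exists a => //; apply/subsetP=> x xC.
have /orP[//|ax] := adjC x a xC aC.
(* Here [a] is a power of [x], so maximality of the order of [a] forces both to generate the same
   subgroup. *)
suffices /eqP-> : <[a]>%g == <[x]>%g by apply: cycle_id.
by rewrite eqEcard cycle_subG ax; apply: max_a.
Qed.

Lemma card_clique_power_graph1 {gT : finGroupType} {G : {group gT}}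
    {C : {set gT}} :
  clique (power_graph1 G) C -> #|C| <= \max_(a in G) weight #[a]%g.
Proof.
rewrite clique_power_graph1E => /andP[cC nC1].
(* The empty clique offers no [a] of maximal order. *)
have [->|C_n0] := eqVneq C set0; first by rewrite cards0.
have [a aC /subsetP sCa] := clique_power_graph_sub_cycle cC C_n0.
have [/subsetP sCG adjC] := clique_power_graphP cC.
pose ord (x : gT) : 'I_#[a]%g.+1 := inord #[x]%g.
have cdC : CD_set (ord @: C).
  apply/andP; split; apply/forall_inP=> _ /imsetP[x xC ->].
    rewrite /ord inord_orderK ?sCa // order_dvdG ?sCa //=.
    by rewrite order_gt1 (memPn nC1).
  apply/forall_inP=> _ /imsetP[y yC ->]; rewrite /ord !inord_orderK ?sCa //.
  by rewrite -!(@mem_cycle_order_dvd _ a) ?sCa ?adjC.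
apply: (bigmax_sup a); first exact: sCG.
apply: leq_trans (weight_max_CD_set cdC).
(* [C] lies in the set of all elements of [<[a]>] whose order occurs in [C]. *)
rewrite -card_order_in_CD_set //; apply/subset_leq_card/subsetP=> x xC.
by rewrite inE sCa //=; apply: imset_f.
Qed.

(** These cliques give the lower bound; they avoid [1] because members of a CD-set exceed 1. *)
Lemma clique_order_in_CD_set {gT : finGroupType} {G : {group gT}} {a : gT}
    {A : {set 'I_#[a]%g.+1}} :
  a \in G -> CD_set A ->
  clique (power_graph1 G) [set x in <[a]>%g | inord #[x]%g \in A].
Proof.
move=> aG /andP[/forall_inP gt1A /forall_inP chainA].
rewrite clique_power_graph1E; apply/andP; split.
  apply/clique_power_graphP; split=> [|x y].
    rewrite -cycle_subG in aG; apply: subset_trans aG.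
    by apply/subsetP=> x; rewrite inE => /andP[].
  rewrite !inE => /andP[ax xA] /andP[ay yA].
  have /forall_inP/(_ _ yA) := chainA _ xA.
  by rewrite !inord_orderK // -!(@mem_cycle_order_dvd _ a).
rewrite inE; apply/negP=> /andP[a1 /gt1A/andP[_]].
by rewrite inord_orderK // order1.
Qed.

Theorem theorem3p7 (gT : finGroupType) (G : {group gT}) :
  clique_number (power_graph1 G) = clique_number (power_graph G) - 1 /\
  clique_number (power_graph G) - 1 = \max_(a in G) weight #[a]%g.
Proof.
split; first exact: clique_number_power_graph1.
rewrite -clique_number_power_graph1; apply/eqP; rewrite eqn_leq.
apply/andP; split; first by apply/bigmax_leqP=> C; apply: card_clique_power_graph1.
apply/bigmax_leqP=> a aG; apply/bigmax_leqP=> A /maxsetp cdA.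
rewrite -card_order_in_CD_set //.
exact/leq_bigmax_cond/clique_order_in_CD_set.
Qed.
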